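(* Let $\mathbb F$ be a commutative field, let $T$ be the ring of ternions over $\mathbb F$, and let $\mathcal X$ and $\mathcal Y$ be the Grassmann images (sets of points of the projective space on $\mathbb F^{20}=\bigwedge^3\mathbb F^6$) of the set of all $X$-submodules and of the set of all $Y$-submodules of $T^2$, respectively. Then the set $\mathcal X\cup\mathcal Y$ is a smooth algebraic variety given by the following equations in the coordinates $p_{ijk}$ ($1\le i<j<k\le 6$): (i) the linear equations $$p_{123}=p_{124}=p_{125}=p_{126}=p_{134}=p_{156}=p_{234}=p_{256}=p_{345}=p_{346}=0,$$ $$p_{236}-p_{245}=0,\qquad p_{136}-p_{145}=0;$$ (ii) the quadratic equations $$p_{135}p_{146}-p_{145}^2=0,\qquad p_{235}p_{246}-p_{245}^2=0;$$ (iii) the quadratic equations $$p_{146}p_{245}-p_{145}p_{246}=0,\qquad p_{135}p_{246}-p_{235}p_{146}=0,\qquad p_{135}p_{245}-p_{145}p_{235}=0;$$ (iv) the quadratic equations $$p_{135}p_{456}-p_{145}p_{356}=0,\qquad p_{145}p_{456}-p_{146}p_{356}=0,$$ $$p_{235}p_{456}-p_{245}p_{356}=0,\qquad p_{245}p_{456}-p_{246}p_{356}=0.$$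
   Context: $\mathbb F$ is an arbitrary commutative field. The ring $T$ of ternions over $\mathbb F$ is the ring of upper triangular $2\times 2$ matrices $\begin{pmatrix} a_{11}&a_{12}\\0&a_{22}\end{pmatrix}$ with entries in $\mathbb F$. $T^2$ is regarded as a free left $T$-module whose elements are written as rows (pairs) $[A,B]$ with $A,B\in T$; the group $\mathrm{GL}_2(T)$ of invertible $2\times2$ matrices over $T$ acts on $T^2$ by multiplication from the right, and hence on the submodules of $T^2$. An $X$-submodule is a submodule in the $\mathrm{GL}_2(T)$-orbit of $$X_0=T\left[\begin{pmatrix}1&0\\0&1\end{pmatrix},\begin{pmatrix}0&0\\0&0\end{pmatrix}\right],$$ and a $Y$-submodule is a submodule in the $\mathrm{GL}_2(T)$-orbit of $$Y_0=T\left[\begin{pmatrix}0&0\\0&1\end{pmatrix},\begin{pmatrix}0&1\\0&0\end{pmatrix}\right].$$ (The $X$-submodules are the free cyclic submodules generated by unimodular pairs; the $Y$-submodules are precisely the free cyclic submodules of $T^2$ which cannot be generated by a unimodular pair.) $T^2$ is identified with $\mathbb F^6$ via $$\left[\begin{pmatrix}a_{11}&a_{12}\\0&a_{22}\end{pmatrix},\begin{pmatrix}b_{11}&b_{12}\\0&b_{22}\end{pmatrix}\right]\mapsto(a_{11},b_{11},a_{22},b_{22},a_{12},b_{12}).$$ Under this identification every $X$-submodule and every $Y$-submodule is a $3$-dimensional subspace of $\mathbb F^6$. Let $e_{ijk}$, $1\le i<j<k\le 6$, be the standard basis vectors of $\mathbb F^{20}=\bigwedge^3\mathbb F^6$, and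 let $p_{ijk}$ denote the corresponding coordinates, used as homogeneous coordinates on the projective space of one-dimensional subspaces of $\mathbb F^{20}$. The Grassmann image of a $3$-dimensional subspace of $\mathbb F^6$ with basis $w_1,w_2,w_3$ is the point $\mathbb F(w_1\wedge w_2\wedge w_3)$; i.e. its coordinate $p_{ijk}$ is the minor on columns $i,j,k$ of the $3\times 6$ matrix with rows $w_1,w_2,w_3$. The Grassmann image of a set of $3$-dimensional subspaces is the set of the Grassmann images of its elements. *)

(* Defs.v *)
From HB Require Import structures.
From mathcomp Require Import all_boot all_order all_algebra.
From mathcomp.multinomials Require Import mpoly.

Set Implicit Arguments.
Unset Strict Implicit.
Unset Printing Implicit Defensive.

Import GRing.Theory.
Local Open Scope ring_scope.

Definition upper_triangular (F : fieldType) : {pred 'M[F]_2} :=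
  [pred M : 'M[F]_2 | M 1 0 == 0].

Fact upper_triangular_subring (F : fieldType) :
  subring_closed (@upper_triangular F).
Proof.
split=> [|M N|M N]; rewrite ?inE.
- by rewrite mxE.
- by move=> /eqP M0 /eqP N0; rewrite !mxE M0 N0 subrr.
- move=> /eqP M0 /eqP N0.
  by rewrite mxE big_ord_recl big_ord1 M0 mul0r add0r
             (_ : lift 0 0 = 1) ?N0 ?mulr0 //; apply/val_inj.
Qed.

HB.instance Definition _ (F : fieldType) :=
  GRing.isSubringClosed.Build 'M[F]_2 (@upper_triangular F)
    (@upper_triangular_subring F).

Record ternion (F : fieldType) : predArgType := Ternion {
  ternion_mx :> 'M[F]_2;
  _ : ternion_mx \in @upper_triangular F }.

HB.instance Definition _ (F : fieldType) := [isSub for @ternion_mx F].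
HB.instance Definition _ (F : fieldType) := [Choice of ternion F by <:].
HB.instance Definition _ (F : fieldType) :=
  [SubChoice_isSubNzRing of ternion F by <:].

Definition tern_mx (F : fieldType) (a11 a12 a22 : F) : 'M[F]_2 :=
  \matrix_(i, j) if i == 0 then (if j == 0 then a11 else a12)
                 else (if j == 0 then 0 else a22).

Fact tern_mx_upper (F : fieldType) (a11 a12 a22 : F) :
  tern_mx a11 a12 a22 \in @upper_triangular F.
Proof. by rewrite inE mxE. Qed.

Definition tern (F : fieldType) (a11 a12 a22 : F) : ternion F :=
  Ternion (tern_mx_upper a11 a12 a22).

Definition tpair (F : fieldType) (A B : ternion F) : 'rV[ternion F]_2 :=
  \row_(j < 2) if j == 0 then A else B.

(* The ternions do not commute, so [unitmx] is not available over them. *)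
Definition GL2 (F : fieldType) (A : 'M[ternion F]_2) : Prop :=
  exists B : 'M[ternion F]_2, A *m B = 1%:M /\ B *m A = 1%:M.

Definition cyclic_submodule (F : fieldType) (g : 'rV[ternion F]_2) :
    'rV[ternion F]_2 -> Prop :=
  fun v => exists t : ternion F, v = t *: g.

Definition in_GL2_orbit (F : fieldType) (U0 U : 'rV[ternion F]_2 -> Prop) :
    Prop :=
  exists2 A : 'M[ternion F]_2, GL2 A &
    forall v, U v <-> exists2 u, U0 u & v = u *m A.

Definition X_submodule (F : fieldType) : ('rV[ternion F]_2 -> Prop) -> Prop :=
  in_GL2_orbit (cyclic_submodule (tpair (tern 1 0 1) (tern 0 0 0))).

Definition Y_submodule (F : fieldType) : ('rV[ternion F]_2 -> Prop) -> Prop :=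
  in_GL2_orbit (cyclic_submodule (tpair (tern 0 0 1) (tern 0 1 0))).

(* [A, B] |-> (a11, b11, a22, b22, a12, b12) *)
Definition toF6 (F : fieldType) (v : 'rV[ternion F]_2) : 'rV[F]_6 :=
  let A : 'M[F]_2 := v 0 0 in
  let B : 'M[F]_2 := v 0 1 in
  \row_(j < 6) [:: A 0 0; B 0 0; A 1 1; B 1 1; A 0 1; B 0 1]`_j.

(* The coordinate of index l in F^20 is p_ijk, where (i, j, k), with
   1 <= i < j < k <= 6, is the l-th triple in lexicographic order. *)
Definition triples : 20.-tuple (nat * nat * nat) :=
  [tuple (1, 2, 3); (1, 2, 4); (1, 2, 5); (1, 2, 6); (1, 3, 4);
         (1, 3, 5); (1, 3, 6); (1, 4, 5); (1, 4, 6); (1, 5, 6);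
         (2, 3, 4); (2, 3, 5); (2, 3, 6); (2, 4, 5); (2, 4, 6);
         (2, 5, 6); (3, 4, 5); (3, 4, 6); (3, 5, 6); (4, 5, 6)]%N.

Definition triple_cols (t : nat * nat * nat) (s : 'I_3) : 'I_6 :=
  inord (nth 0%N [:: t.1.1; t.1.2; t.2] s).-1.

Definition plucker (F : fieldType) (W : 'M[F]_(3, 6)) : 'rV[F]_20 :=
  \row_(l < 20) \det (colsub (triple_cols (tnth triples l)) W).

(* Points of the projective space on a vector space are its 1-dimensional
   subspaces. *)
Definition grassmann_image (F : fieldType) (W : {vspace 'rV[F]_6})
    (L : {vspace 'rV[F]_20}) : Prop :=
  exists2 w : 3.-tuple 'rV[F]_6, basis_of W w &
    L = <[plucker (\matrix_(i < 3) tnth w i)]>%VS.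

Definition grassmann_image_set (F : fieldType)
    (C : ('rV[ternion F]_2 -> Prop) -> Prop) (L : {vspace 'rV[F]_20}) : Prop :=
  exists U : 'rV[ternion F]_2 -> Prop, exists W : {vspace 'rV[F]_6},
    [/\ C U, forall v, toF6 v \in W <-> U v & grassmann_image W L].

(* Meaningful only for 1 <= i < j < k <= 6. *)
Definition p (F : fieldType) (i j k : nat) : {mpoly F[20]} :=
  'X_(inord (index (i, j, k) triples)).
Arguments p {F} i j k.

Definition equations_i (F : fieldType) : seq {mpoly F[20]} :=
  [:: p 1 2 3; p 1 2 4; p 1 2 5; p 1 2 6; p 1 3 4;
      p 1 5 6; p 2 3 4; p 2 5 6; p 3 4 5; p 3 4 6;
      p 2 3 6 - p 2 4 5;
      p 1 3 6 - p 1 4 5].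

Definition equations_ii (F : fieldType) : seq {mpoly F[20]} :=
  [:: p 1 3 5 * p 1 4 6 - p 1 4 5 ^+ 2;
      p 2 3 5 * p 2 4 6 - p 2 4 5 ^+ 2].

Definition equations_iii (F : fieldType) : seq {mpoly F[20]} :=
  [:: p 1 4 6 * p 2 4 5 - p 1 4 5 * p 2 4 6;
      p 1 3 5 * p 2 4 6 - p 2 3 5 * p 1 4 6;
      p 1 3 5 * p 2 4 5 - p 1 4 5 * p 2 3 5].

Definition equations_iv (F : fieldType) : seq {mpoly F[20]} :=
  [:: p 1 3 5 * p 4 5 6 - p 1 4 5 * p 3 5 6;
      p 1 4 5 * p 4 5 6 - p 1 4 6 * p 3 5 6;
      p 2 3 5 * p 4 5 6 - p 2 4 5 * p 3 5 6;
      p 2 4 5 * p 4 5 6 - p 2 4 6 * p 3 5 6].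

Definition equations (F : fieldType) : seq {mpoly F[20]} :=
  equations_i F ++ equations_ii F ++ equations_iii F ++ equations_iv F.

Definition homogeneous (F : fieldType) (n : nat) (f : {mpoly F[n]}) : Prop :=
  exists k : nat, f \is k.-homog.

Definition proj_zeros (F : fieldType) (n : nat) (fs : seq {mpoly F[n.+1]})
    (L : {vspace 'rV[F]_n.+1}) : Prop :=
  \dim L = 1%N /\
  forall v, v \in L -> forall f, f \in fs -> f.@[fun i => v 0 i] = 0.

Definition in_ideal (F : fieldType) (n : nat) (gs : seq {mpoly F[n]})
    (f : {mpoly F[n]}) : Prop :=
  exists q : 'I_(size gs) -> {mpoly F[n]}, f = \sum_i q i * gs`_i.

Definition jacobian (F : fieldType) (n : nat) (gs : seq {mpoly F[n]})
    (x : 'I_n -> F) : 'M[F]_(size gs, n) :=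
  \matrix_(i, j) (mderiv j gs`_i).@[x].

(* The closed subscheme of P^n over F cut out by the forms fs is smooth of
   dimension d at the point with homogeneous coordinates x if, on a
   neighbourhood {h != 0} of x, its ideal is generated by n - d forms whose
   differentials are linearly independent at x.  By Euler's identity, the rank
   of the Jacobian in homogeneous coordinates at a zero of the forms agrees with
   the rank in an affine chart.  No condition is imposed outside the zero set. *)
Definition smooth_at (F : fieldType) (n : nat) (fs : seq {mpoly F[n.+1]})
    (d : nat) (x : 'I_n.+1 -> F) : Prop :=
  exists (gs : seq {mpoly F[n.+1]}) (h : {mpoly F[n.+1]}),
    [/\ (size gs + d)%N = n,
        forall g, g \in gs -> homogeneous g /\ in_ideal fs g,
        row_free (jacobian gs x),
        homogeneous h /\ h.@[x] != 0 &
        forall f, f \in fs -> in_ideal gs (h * f)].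

(* Smoothness over F is a geometric property: it is tested at the points with
   coordinates in arbitrary extension fields K of F.  (When F is finite, the
   F-rational points alone do not determine even the dimension.) *)
Definition smooth_variety (F : fieldType) (n : nat)
    (fs : seq {mpoly F[n.+1]}) : Prop :=
  (forall f, f \in fs -> homogeneous f) /\
  exists d : nat, forall (K : fieldType) (iota : {rmorphism F -> K})
      (x : 'I_n.+1 -> K),
    let fsK := [seq map_mpoly iota f | f <- fs] in
    (exists i, x i != 0) ->
    (forall f, f \in fsK -> f.@[x] = 0) ->
    smooth_at fsK d x.

(* Main.v *)
(* Writing a pair in T^2 as a triple (r, q, s) of rows of its 11-, 12- and
   22-entries, GL_2(T) becomes the group of invertible block matrices
   [[P, Q], [0, S]].  The X- and Y-submodules are thus exactly the T(r, q, s)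
   with s <> 0 and (r, k) <> 0, where k = s_0 q_1 - s_1 q_0.  The nonzero
   Pluecker coordinates of T(r, q, s) are r_0 (s_0^2, s_0 s_1, s_1^2),
   r_1 (s_0^2, s_0 s_1, s_1^2) and k (s_0, s_1): this parametrizes the
   rational normal scroll S(2,2,1), of dimension 3.  It is covered by the
   charts where one of x0, x2, y0, y2, z0, z1 does not vanish, and on each of
   them twelve linear and four quadratic equations with triangular Jacobian
   generate the ideal. *)
Require Import Defs.
From mathcomp Require Import all_boot all_order all_algebra.
From mathcomp.multinomials Require Import mpoly.
From mathcomp Require Import ring.

Set Implicit Arguments.
Unset Strict Implicit.
Unset Printing Implicit Defensive.

Import GRing.Theory.
Local Open Scope ring_scope.

(** * Matrices of ternions as triples of matrices over the field *)

Lemma tern_eta (F : fieldType) (A : ternion F) :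
  A = tern ((A : 'M_2) 0 0) ((A : 'M_2) 0 1) ((A : 'M_2) 1 1).
Proof.
apply/val_inj/matrixP=> i j; rewrite mxE /=.
have /eqP A10 : (A : 'M_2) 1 0 == 0 by case: A.
by case: i j => [[|[|//]] ?] [[|[|//]] ?] /=; rewrite -1?A10;
  congr fun_of_matrix; apply/val_inj.
Qed.

Lemma ternM (F : fieldType) (a b c a' b' c' : F) :
  tern a b c * tern a' b' c' = tern (a * a') (a * b' + b * c') (c * c').
Proof.
apply/val_inj/matrixP=> i j; rewrite rmorphM /= !mxE big_ord_recl big_ord1.
rewrite !mxE /=.
by case: i j => [[|[|//]] ?] [[|[|//]] ?] //=; ring.
Qed.

Lemma ternD (F : fieldType) (a b c a' b' c' : F) :
  tern a b c + tern a' b' c' = tern (a + a') (b + b') (c + c').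
Proof.
apply/val_inj/matrixP=> i j; rewrite raddfD /= !mxE.
by case: i j => [[|[|//]] ?] [[|[|//]] ?] //=; rewrite addr0.
Qed.

Lemma tern_sum (F : fieldType) (I : finType) (a b c : I -> F) :
  \sum_i tern (a i) (b i) (c i) =
  tern (\sum_i a i) (\sum_i b i) (\sum_i c i).
Proof.
elim: (index_enum I) => [|l e IH]; last by rewrite !big_cons IH ternD.
rewrite !big_nil.
apply/val_inj/matrixP=> i j; rewrite raddf0 !mxE.
by case: i j => [[|[|//]] ?] [[|[|//]] ?].
Qed.

(** After reordering rows and columns this is the block matrix [[P, Q], [0, S]], which explains the
    product formula [ternmxM]. *)
Definition ternmx (F : fieldType) m n (P Q S : 'M[F]_(m, n)) :
    'M[ternion F]_(m, n) :=
  \matrix_(i, j) tern (P i j) (Q i j) (S i j).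

Lemma ternmx_eta (F : fieldType) m n (M : 'M[ternion F]_(m, n)) :
  exists P Q S, M = ternmx P Q S.
Proof.
exists (\matrix_(i, j) (M i j : 'M_2) 0 0), (\matrix_(i, j) (M i j : 'M_2) 0 1),
       (\matrix_(i, j) (M i j : 'M_2) 1 1).
by apply/matrixP=> i j; rewrite !mxE -tern_eta.
Qed.

Lemma ternmxM (F : fieldType) m n k (P Q S : 'M[F]_(m, n))
    (P' Q' S' : 'M[F]_(n, k)) :
  ternmx P Q S *m ternmx P' Q' S' =
  ternmx (P *m P') (P *m Q' + Q *m S') (S *m S').
Proof.
apply/matrixP=> i j; rewrite !mxE -big_split /= -tern_sum.
by apply: eq_bigr => l _; rewrite !mxE ternM.
Qed.

Lemma ternmxZ (F : fieldType) m n (a b c : F) (P Q S : 'M[F]_(m, n)) :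
  tern a b c *: ternmx P Q S = ternmx (a *: P) (a *: Q + b *: S) (c *: S).
Proof. by apply/matrixP=> i j; rewrite !mxE ternM. Qed.

Lemma ternmx_inj (F : fieldType) m n (P Q S P' Q' S' : 'M[F]_(m, n)) :
  ternmx P Q S = ternmx P' Q' S' -> [/\ P = P', Q = Q' & S = S'].
Proof.
move=> E; split; apply/matrixP=> i j; move: E => /matrixP/(_ i j);
  rewrite !mxE => /(congr1 val) /= Eij.
- by have := congr1 (fun M : 'M_2 => M 0 0) Eij; rewrite !mxE.
- by have := congr1 (fun M : 'M_2 => M 0 1) Eij; rewrite !mxE.
- by have := congr1 (fun M : 'M_2 => M 1 1) Eij; rewrite !mxE.
Qed.

Lemma ternmx1 (F : fieldType) n : ternmx 1%:M 0 1%:M = 1%:M :> 'M[ternion F]_n.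
Proof.
apply/matrixP=> i j; rewrite !mxE; apply/val_inj/matrixP=> k l.
case: (i == j); rewrite ?mulr1n ?mulr0n ?rmorph1 ?raddf0 !mxE;
by case: k l => [[|[|//]] ?] [[|[|//]] ?].
Qed.

(** * Invertible ternion matrices and the orbits of cyclic submodules *)

Lemma GL2_ternmx (F : fieldType) (P Q S : 'M[F]_2) :
  GL2 (ternmx P Q S) <-> P \in unitmx /\ S \in unitmx.
Proof.
split=> [[B [AB _]]|[uP uS]].
  have [P' [Q' [S' EB]]] := ternmx_eta B.
  move: AB; rewrite EB ternmxM -ternmx1 => /ternmx_inj [PP' _ SS'].
  by split; [case: (mulmx1_unit PP') | case: (mulmx1_unit SS')].
(* The inverse of the block matrix [[P, Q], [0, S]]. *)
exists (ternmx (invmx P) (- (invmx P *m Q *m invmx S)) (invmx S)).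
rewrite !ternmxM !(mulmxV, mulVmx) // mulmxN mulNmx !mulmxA mulmxV // mul1mx.
by rewrite addNr mulmxKV // addrN ternmx1.
Qed.

Lemma in_GL2_orbit_cyclic (F : fieldType) (g : 'rV[ternion F]_2) U :
  in_GL2_orbit (cyclic_submodule g) U <->
  exists2 A, GL2 A & forall v, U v <-> cyclic_submodule (g *m A) v.
Proof.
split=> -[A GA UA]; exists A => // v; rewrite UA.
  split=> [[u [t ->] ->]|[t ->]]; first by exists t; rewrite scalemxAl.
  by exists (t *: g); [exists t | rewrite scalemxAl].
split=> [[t ->]|[u [t ->] ->]]; last by exists t; rewrite scalemxAl.
by exists (t *: g); [exists t | rewrite scalemxAl].
Qed.

Definition row2_minor (F : fieldType) (u v : 'rV[F]_2) : F :=
  u 0 0 * v 0 1 - u 0 1 * v 0 0.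

Lemma det_mx22_row (F : fieldType) (M : 'M[F]_2) :
  \det M = row2_minor (row 0 M) (row 1 M).
Proof.
rewrite (expand_det_row _ 0) big_ord_recl big_ord1 /cofactor !det_mx11 !mxE /=.
rewrite expr0 expr1 mul1r mulN1r mulrN /row2_minor !mxE.
by congr (_ * M _ _ - M _ _ * M _ _); apply/val_inj.
Qed.

Lemma unitmx_extend_row (F : fieldType) n (r : 'rV[F]_n.+1) :
  r != 0 -> exists2 P, P \in unitmx & row 0 P = r.
Proof.
move=> r0; pose f : 'M[F]_n.+1 := \matrix_i r.
have ef : delta_mx 0 0 *m f = r by rewrite -rowE rowK.
(* Since r is nonzero, [f] is injective on the line of the first unit vector, so some invertible
   matrix agrees with it there. *)
have [|P uP eP] := @complete_unitmx _ _ _ (delta_mx 0 0 : 'rV_n.+1) f.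
  by rewrite ef rank_rV r0 mxrank_delta.
by exists P; rewrite // rowE -eP.
Qed.

Lemma tpair_X0 (F : fieldType) :
  tpair (tern 1 0 1) (tern 0 0 0) =
  ternmx (delta_mx 0 0) 0 (delta_mx 0 0) :> 'rV[ternion F]_2.
Proof.
by apply/rowP=> j; rewrite !mxE; case: j => [[|[|//]] ?].
Qed.

Lemma tpair_Y0 (F : fieldType) :
  tpair (tern 0 0 1) (tern 0 1 0) =
  ternmx 0 (delta_mx 0 1) (delta_mx 0 0) :> 'rV[ternion F]_2.
Proof.
by apply/rowP=> j; rewrite !mxE; case: j => [[|[|//]] ?].
Qed.

(** A block matrix sends the standard generator to the triple of first rows of P, Q and S. Each
    nonzero vector is the first row of an invertible P or S, and Q is arbitrary. *)
Lemma X_submoduleP (F : fieldType) (U : 'rV[ternion F]_2 -> Prop) :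
  X_submodule U <-> exists r q s,
    [/\ r != 0, s != 0 & forall v, U v <-> cyclic_submodule (ternmx r q s) v].
Proof.
rewrite /X_submodule in_GL2_orbit_cyclic tpair_X0.
have row_neq0 (P : 'M[F]_2) : P \in unitmx -> row 0 P != 0.
  move=> uP; apply: contraTneq uP => P0.
  by rewrite unitmxE det_mx22_row P0 /row2_minor !mxE !mul0r subrr unitr0.
split=> [[A GA UA]|[r [q [s [r0 s0 Uv]]]]].
  have [P [Q [S EA]]] := ternmx_eta A.
  move: GA; rewrite EA => /GL2_ternmx [uP uS].
  exists (row 0 P), (row 0 Q), (row 0 S); split=> [||v]; rewrite ?row_neq0 //.
  by rewrite UA EA ternmxM mul0mx addr0 -!rowE.
have [P uP rP] := unitmx_extend_row r0; have [S uS sS] := unitmx_extend_row s0.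
exists (ternmx P (\matrix_i q) S); first exact/GL2_ternmx.
by move=> v; rewrite Uv ternmxM mul0mx addr0 -!rowE rP sS rowK.
Qed.

(** Here the standard generator picks the two rows of the same block S, as s and q, so invertibility
    of S becomes the condition on the minor; the block P may be the identity. *)
Lemma Y_submoduleP (F : fieldType) (U : 'rV[ternion F]_2 -> Prop) :
  Y_submodule U <-> exists q s, row2_minor s q != 0 /\
    forall v, U v <-> cyclic_submodule (ternmx 0 q s) v.
Proof.
rewrite /Y_submodule in_GL2_orbit_cyclic tpair_Y0.
split=> [[A GA UA]|[q [s [sq0 Uv]]]].
  have [P [Q [S EA]]] := ternmx_eta A.
  move: GA; rewrite EA => /GL2_ternmx [_]; rewrite unitmxE det_mx22_row => uS.
  exists (row 1 S), (row 0 S); split=> [|v]; first by rewrite -unitfE.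
  by rewrite UA EA ternmxM !mul0mx add0r -!rowE.
pose S : 'M_2 := \matrix_i (if i == 0 then s else q).
have [S0 S1] : row 0 S = s /\ row 1 S = q by rewrite !rowK.
exists (ternmx 1%:M 0 S).
  by apply/GL2_ternmx; rewrite unitmx1 unitmxE det_mx22_row S0 S1 unitfE.
by move=> v; rewrite Uv ternmxM !mul0mx add0r -!rowE S0 S1.
Qed.

(** * Cyclic submodules as row spaces in the six-dimensional space *)

Lemma toF6_ternmx (F : fieldType) (r q s : 'rV[F]_2) :
  toF6 (ternmx r q s) =
  \row_j [:: r 0 0; r 0 1; s 0 0; s 0 1; q 0 0; q 0 1]`_j.
Proof. by rewrite /toF6 !mxE. Qed.

Lemma toF6_inj (F : fieldType) : injective (@toF6 F).
Proof.
move=> u v.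
have [r [q [s ->]]] := ternmx_eta u; have [r' [q' [s' ->]]] := ternmx_eta v.
rewrite !toF6_ternmx => /rowP E.
have E_ k (lt_k : (k < 6)%N) := E (Ordinal lt_k).
have := (E_ 0%N isT, E_ 1%N isT, E_ 2%N isT, E_ 3%N isT, E_ 4%N isT,
         E_ 5%N isT).
rewrite !mxE /= => -[[[[[r0 r1] s0] s1] q0] q1].
congr ternmx; apply/rowP=> -[[|[|//]] ?];
  [move: r0 | move: r1 | move: q0 | move: q1 | move: s0 | move: s1];
  by congr (_ = _); congr fun_of_matrix; apply/val_inj.
Qed.

Lemma toF6_surj (F : fieldType) (w : 'rV[F]_6) : exists v, toF6 v = w.
Proof.
pose c k : F := w 0 (inord k).
exists (ternmx (\row_j [:: c 0%N; c 1%N]`_j) (\row_j [:: c 4%N; c 5%N]`_j)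
               (\row_j [:: c 2%N; c 3%N]`_j)).
rewrite toF6_ternmx; apply/rowP=> j; rewrite !mxE.
case: j => [[|[|[|[|[|[|//]]]]]] ?] /=; congr fun_of_matrix;
  by apply/val_inj; rewrite /= inordK.
Qed.

(** The rows are the images of E11 g, E22 g and E12 g, where g is the generator (r, q, s) and the
    Eij are matrix units. *)
Definition cyclic_basis (F : fieldType) (r q s : 'rV[F]_2) : 'M[F]_(3, 6) :=
  \matrix_(i, j)
    (nth [::] [:: [:: r 0 0; r 0 1; 0; 0; q 0 0; q 0 1];
                  [:: 0; 0; s 0 0; s 0 1; 0; 0];
                  [:: 0; 0; 0; 0; s 0 0; s 0 1]] i)`_j.

Lemma cyclic_submodule_row (F : fieldType) (r q s : 'rV[F]_2) v :
  cyclic_submodule (ternmx r q s) v <->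
  exists u, toF6 v = u *m cyclic_basis r q s.
Proof.
have toF6Z a b c : toF6 (tern a b c *: ternmx r q s) =
    (\row_i [:: a; c; b]`_i) *m cyclic_basis r q s.
  rewrite ternmxZ toF6_ternmx; apply/rowP=> j.
  rewrite !mxE !big_ord_recl big_ord0 !mxE /=.
  by case: j => [[|[|[|[|[|[|//]]]]]] ?] /=; ring.
split=> [[t ->]|[u Ev]]; first by rewrite (tern_eta t) toF6Z; eexists.
exists (tern (u 0 0) (u 0 2) (u 0 1)); apply: toF6_inj; rewrite toF6Z Ev.
congr (_ *m _); apply/rowP=> i; rewrite mxE.
by case: i => [[|[|[|//]]] ?] /=; congr fun_of_matrix; apply/val_inj.
Qed.

(** * Pluecker coordinates and the parametrization of the scroll *)

Lemma det_mx33 (R : comNzRingType) (M : 'M[R]_3) :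
  \det M = M 0 0 * (M 1 1 * M 2 2 - M 1 2 * M 2 1)
         - M 0 1 * (M 1 0 * M 2 2 - M 1 2 * M 2 0)
         + M 0 2 * (M 1 0 * M 2 1 - M 1 1 * M 2 0).
Proof.
rewrite (expand_det_row _ 0) !big_ord_recl big_ord0 /cofactor.
do 3![rewrite (expand_det_row _ 0) !big_ord_recl big_ord0 /cofactor !det_mx11].
rewrite !mxE /=.
(* Indexing by natural numbers identifies the equal ordinals that the expansion writes in different
   forms. *)
pose m i j := M (inord i) (inord j).
have mE i j : M i j = m i j by rewrite /m !inord_val.
rewrite !mE /= /bump /=; ring.
Qed.

(* The 2x2 minors of [[x0, x1, y0, y1, z0], [x1, x2, y1, y2, z1]], except that
   x0 y2 - x1 y1 and x1 y1 - x2 y0 are replaced by their sum. *)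
Definition scroll_quadrics (R : pzRingType) (x0 x1 x2 y0 y1 y2 z0 z1 : R) :
    seq R :=
  [:: x0 * x2 - x1 ^+ 2; y0 * y2 - y1 ^+ 2;
      x2 * y1 - x1 * y2; x0 * y2 - y0 * x2; x0 * y1 - x1 * y0;
      x0 * z1 - x1 * z0; x1 * z1 - x2 * z0;
      y0 * z1 - y1 * z0; y1 * z1 - y2 * z0].

(** The general solution of the linear equations: x1 and y1 occur twice because p_136 = p_145 and
    p_236 = p_245. *)
Definition scroll_point (F : fieldType) (x0 x1 x2 y0 y1 y2 z0 z1 : F) :
    'rV[F]_20 :=
  \row_l [:: 0; 0; 0; 0; 0; x0; x1; x1; x2; 0; 0; y0; y1; y1; y2; 0; 0; 0;
             z0; z1]`_l.

(** Split the columns into the pairs 12, 34, 56. One column from each pair gives a product of an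
    entry of r and two of s; one of the columns 3, 4 together with 5 and 6 gives an entry of s times
    k. Every other minor has a zero row or two proportional rows. *)
Lemma plucker_cyclic_basis (F : fieldType) (r q s : 'rV[F]_2) :
  let a := r 0 0 in let b := r 0 1 in let e := s 0 0 in let f := s 0 1 in
  let k := row2_minor s q in
  plucker (cyclic_basis r q s) =
  scroll_point (a * e ^+ 2) (a * e * f) (a * f ^+ 2)
    (b * e ^+ 2) (b * e * f) (b * f ^+ 2) (k * e) (k * f).
Proof.
apply/rowP=> l; rewrite !mxE det_mx33 !mxE /row2_minor.
case: l => l lt_l; rewrite !(tnth_nth (0, 0, 0)%N) /=.
move: l lt_l; do 20![case=> [_|]; first by
  rewrite /triple_cols /= !inordK //=; ring].
by [].
Qed.

Lemma equationsE (F : fieldType) :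
  equations F = equations_i F ++
    scroll_quadrics (p 1 3 5) (p 1 4 5) (p 1 4 6) (p 2 3 5) (p 2 4 5) (p 2 4 6)
                    (p 3 5 6) (p 4 5 6).
Proof. by []. Qed.

Lemma zeros_equationsP (F : fieldType) (v : 'rV[F]_20) :
  (forall f, f \in equations F -> f.@[fun i => v 0 i] = 0) <->
  exists x0 x1 x2 y0 y1 y2 z0 z1,
    v = scroll_point x0 x1 x2 y0 y1 y2 z0 z1 /\
    all (pred1 0) (scroll_quadrics x0 x1 x2 y0 y1 y2 z0 z1).
Proof.
pose c k := v 0 (inord k).
have evp i j k : (p i j k).@[fun i => v 0 i] = c (index (i, j, k) triples).
  exact: mevalXU.
have evE : (forall f, f \in equations F -> f.@[fun i => v 0 i] = 0) <->
    all (fun f => f.@[fun i => v 0 i] == 0) (equations F).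
  by split=> [v0|/allP v0 f /v0/eqP//]; apply/allP=> f /v0 ->.
rewrite evE equationsE all_cat /=.
(* Abstracting the variables keeps unification from unfolding them. *)
move: (@p F) evp => q evp.
rewrite !expr2 !(mevalB, mevalM) !evp /=.
split=> [|[x0 [x1 [x2 [y0 [y1 [y2 [z0 [z1 [Ev]]]]]]]]]].
  case/andP=> /and5P [/eqP c0 /eqP c1 /eqP c2 /eqP c3].
  case/and5P => /eqP c4 /eqP c9 /eqP c10 /eqP c15.
  case/and5P => /eqP c16 /eqP c17 /eqP c12 /eqP c6 _ Q.
  exists (c 5), (c 7), (c 8), (c 11), (c 13), (c 14), (c 18), (c 19).
  split; last by rewrite /= !expr2.
  apply/rowP=> l; have -> : v 0 l = c l by rewrite /c inord_val.
  rewrite mxE; case: l => l /=; move: l.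
  by do 20![case=> [_|]; first by rewrite /= ?(subr0_eq c6) ?(subr0_eq c12)].
have cE k : (k < 20)%N -> c k =
    [:: 0; 0; 0; 0; 0; x0; x1; x1; x2; 0; 0; y0; y1; y1; y2; 0; 0; 0;
        z0; z1]`_k.
  by move=> lt_k; rewrite /c Ev mxE inordK.
by rewrite /= !expr2 !cE //= !subrr !eqxx.
Qed.

(** If one of x0, y0, z0 is nonzero, then e = 1 and f is the ratio of the next coordinate of its
    group to it. If all three vanish, the quadrics force x1 = y1 = 0, and (e, f) = (0, 1) leaves x2,
    y2, z1 as free parameters. *)
Lemma scroll_parametrization (F : fieldType) (x0 x1 x2 y0 y1 y2 z0 z1 : F) :
  all (pred1 0) (scroll_quadrics x0 x1 x2 y0 y1 y2 z0 z1) ->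
  exists a b k e f,
    [/\ (e != 0) || (f != 0),
        [/\ x0 = a * e ^+ 2, x1 = a * e * f & x2 = a * f ^+ 2],
        [/\ y0 = b * e ^+ 2, y1 = b * e * f & y2 = b * f ^+ 2],
        z0 = k * e & z1 = k * f].
Proof.
rewrite /= !subr_eq0 => /and5P [/eqP x02 /eqP y02 /eqP xy21 /eqP xy02].
case/and5P=> /eqP xy01 /eqP xz01 /eqP xz12 /eqP yz01 /andP [/eqP yz12 _].
have sq0 (u : F) : 0 = u ^+ 2 -> u = 0.
  by move/esym/eqP; rewrite expf_eq0 /= => /eqP.
have [x00|x0n] := eqVneq x0 0; last first.
  pose t := x1 / x0; exists x0, y0, z0, 1, t; rewrite oner_neq0 !expr1n !mulr1.
  have Ex1 : x1 = x0 * t by rewrite mulrC divfK.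
  split=> //; [split=> // | split=> // |]; apply: (mulfI x0n).
  - by rewrite x02 Ex1; ring.
  - by rewrite xy01 Ex1; ring.
  - rewrite xy02 [RHS]mulrCA; congr (_ * _).
    by apply: (mulfI x0n); rewrite x02 Ex1; ring.
  - by rewrite xz01 Ex1; ring.
move: x02 xy02 xy01 xz01; rewrite x00 !mul0r => /sq0 x10.
rewrite x10 !mul0r in xz12 *.
have [y00|y0n] := eqVneq y0 0 => /esym/eqP.
  move: y02; rewrite y00 mul0r => /sq0 y10 _ _ _.
  have [z00|z0n] := eqVneq z0 0.
    exists x2, y2, z1, 0, 1; rewrite oner_neq0 orbT y10 z00.
    by rewrite !expr0n !expr1n !(mulr0, mulr1, mul0r).
  exists 0, 0, z0, 1, (z1 / z0); rewrite oner_neq0 !mul0r y10 !mulr1.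
  move: xz12 yz12; rewrite y10 mul0r => /esym/eqP.
  rewrite mulf_eq0 (negPf z0n) orbF => /eqP -> /esym/eqP.
  rewrite mulf_eq0 (negPf z0n) orbF => /eqP ->.
  by split=> //; rewrite mulrC divfK.
rewrite mulf_eq0 (negPf y0n) /= => /eqP -> _ _.
pose t := y1 / y0; exists 0, y0, z0, 1, t.
rewrite oner_neq0 !expr1n !mulr1 !mul0r.
have Ey1 : y1 = y0 * t by rewrite mulrC divfK.
by split=> //; [split=> // |]; apply: (mulfI y0n); rewrite ?y02 ?yz01 Ey1; ring.
Qed.

(** * Grassmann images as the zeros of the equations *)

Lemma free_row_free (F : fieldType) m n (w : m.-tuple 'rV[F]_n) :
  free w = row_free (\matrix_(i < m) tnth w i).
Proof.
have sumE (k : 'I_m -> F) :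
    \sum_(i < m) k i *: w`_i = (\row_i k i) *m \matrix_(i < m) tnth w i.
  rewrite mulmx_sum_row; apply: eq_bigr => i _.
  by rewrite rowK mxE (tnth_nth 0).
apply/freeP/idP => [w0 | fw k].
  apply: inj_row_free => u.
  rewrite -[u](_ : \row_i u 0 i = u) -?sumE => [/w0 u0|].
    by apply/rowP=> i; rewrite !mxE.
  by apply/rowP=> i; rewrite mxE.
rewrite sumE => kw0; have /rowP k0 : \row_i k i = 0.
  by apply: (row_free_inj fw); rewrite kw0 mul0mx.
by move=> i; have := k0 i; rewrite !mxE.
Qed.

(** For invertible C this is a change of basis, so the Grassmann image does not depend on the
    basis. *)
Lemma plucker_mulmx (F : fieldType) (C : 'M[F]_3) (W : 'M[F]_(3, 6)) :
  plucker (C *m W) = \det C *: plucker W.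
Proof.
by apply/rowP=> l; rewrite !mxE -det_mulmx mulmx_colsub.
Qed.

Lemma plucker_row_free (F : fieldType) (W : 'M[F]_(3, 6)) :
  plucker W != 0 -> row_free W.
Proof.
move=> W0; apply: inj_row_free => u uW; apply: contra_neq_eq W0 => u0.
apply/rowP=> l; rewrite !mxE; apply/eqP/det0P; exists u => //.
by rewrite mulmx_colsub uW; apply/matrixP=> i j; rewrite !mxE.
Qed.

Lemma scroll_pointZ (F : fieldType) (c x0 x1 x2 y0 y1 y2 z0 z1 : F) :
  c *: scroll_point x0 x1 x2 y0 y1 y2 z0 z1 =
  scroll_point (c * x0) (c * x1) (c * x2) (c * y0) (c * y1) (c * y2)
    (c * z0) (c * z1).
Proof.
apply/rowP=> -[l lt_l]; rewrite !mxE /=.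
by move: l lt_l; do 20![case=> [_|]; first by rewrite /= ?mulr0].
Qed.

Lemma plucker_cyclic_basis_neq0 (F : fieldType) (r q s : 'rV[F]_2) :
  s != 0 -> (r != 0) || (row2_minor s q != 0) ->
  plucker (cyclic_basis r q s) != 0.
Proof.
have rv2_neq0 (u : 'rV[F]_2) : (u != 0) = (u 0 0 != 0) || (u 0 1 != 0).
  rewrite -negb_and; congr (~~ _); apply/eqP/andP=> [->|[/eqP u0 /eqP u1]].
    by rewrite !mxE.
  by apply/rowP=> -[[|[|//]] ?]; rewrite mxE;
    [rewrite -[RHS]u0 | rewrite -[RHS]u1]; congr fun_of_matrix; apply/val_inj.
rewrite !rv2_neq0 => s0 rk0; apply/eqP.
rewrite plucker_cyclic_basis => /rowP P0.
have P_ k (lt_k : (k < 20)%N) := P0 (Ordinal lt_k).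
(* With a, b the entries of r and e, f those of s, these six coordinates are a e^2, a f^2, b e^2, b
   f^2, k e and k f. They cannot all vanish if (e, f) and (a, b, k) are nonzero. *)
have := (P_ 5%N isT, P_ 8%N isT, P_ 11%N isT, P_ 14%N isT, P_ 18%N isT,
         P_ 19%N isT).
rewrite !mxE /= => -[[[[[/eqP + /eqP +] /eqP +] /eqP +] /eqP +] /eqP +].
rewrite !mulf_eq0 /=; move: s0 rk0.
by do 5!case: (_ == 0).
Qed.

(** The two types are told apart by whether r vanishes; when r = 0, the nonzero minor already forces
    s to be nonzero. *)
Lemma X_or_Y_submoduleP (F : fieldType) (U : 'rV[ternion F]_2 -> Prop) :
  X_submodule U \/ Y_submodule U <-> exists r q s,
    [/\ s != 0, (r != 0) || (row2_minor s q != 0) &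
        forall v, U v <-> cyclic_submodule (ternmx r q s) v].
Proof.
rewrite X_submoduleP Y_submoduleP.
split=> [[[r [q [s [r0 s0 Uv]]]]|[q [s [k0 Uv]]]]|[r [q [s [s0 rk0 Uv]]]]].
- by exists r, q, s; rewrite r0.
- exists 0, q, s; rewrite k0 orbT; split=> //.
  by apply: contraNneq k0 => ->; rewrite /row2_minor !mxE !mul0r subrr.
- have [r0|r0] := eqVneq r 0; last by left; exists r, q, s.
  by right; exists q, s; move: rk0 Uv; rewrite r0 eqxx.
Qed.

(** The class consists of all predicates with the same elements as T(r, q, s), because such
    predicates need not be equal as functions. *)
Lemma grassmann_image_cyclicP (F : fieldType) (r q s : 'rV[F]_2)
    (L : {vspace 'rV[F]_20}) :
  plucker (cyclic_basis r q s) != 0 ->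
  grassmann_image_set
    (fun U => forall v, U v <-> cyclic_submodule (ternmx r q s) v) L <->
  L = <[plucker (cyclic_basis r q s)]>%VS.
Proof.
set B := cyclic_basis r q s => B0; split=> [[U [W [UE WU [w wW ->]]]]|->].
  set M := \matrix_i tnth w i.
  have MB : (M <= B)%MS.
    apply/row_subP=> i; rewrite rowK.
    have [v vw] := toF6_surj (tnth w i).
    have : tnth w i \in W by rewrite (basis_mem wW) ?mem_tnth.
    by rewrite -vw WU UE cyclic_submodule_row => -[u ->]; apply: submxMl.
  have fM : row_free M by rewrite -free_row_free (basis_free wW).
  have [C EM] := submxP MB.
  (* [M] has rank 3 and factors through [C], so [C] has full rank. *)
  have uC : C \in unitmx.
    by rewrite -row_free_unit -row_leq_rank -{1}(eqP fM) EM mxrankM_maxl.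
  rewrite EM plucker_mulmx; apply/eqP; rewrite eqEsubv.
  apply/andP; split; apply/vlineP; first by exists (\det C).
  exists (\det C)^-1; rewrite scalerA mulVf ?scale1r //.
  by rewrite -unitfE -unitmxE.
pose w := [tuple row i B | i < 3].
have wB : \matrix_i tnth w i = B.
  by apply/row_matrixP=> i; rewrite rowK tnth_mktuple.
exists (cyclic_submodule (ternmx r q s)), <<w>>%VS; split=> // [v|].
  rewrite cyclic_submodule_row -/B; split=> [|[u ->]].
    move/coord_span=> {1}->; exists (\row_i coord w i (toF6 v)).
    rewrite mulmx_sum_row; apply: eq_bigr => i _.
    by rewrite mxE -tnth_nth tnth_mktuple.
  rewrite mulmx_sum_row; apply: rpred_sum => i _; apply/rpredZ/memv_span.
  by rewrite -(tnth_mktuple (fun i => row i B)) mem_tnth.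
exists w; last by rewrite wB.
by rewrite /basis_of eqxx free_row_free wB plucker_row_free.
Qed.

Lemma scroll_point_plucker (F : fieldType) (x0 x1 x2 y0 y1 y2 z0 z1 : F) :
  all (pred1 0) (scroll_quadrics x0 x1 x2 y0 y1 y2 z0 z1) ->
  exists r q s, s != 0 /\
    scroll_point x0 x1 x2 y0 y1 y2 z0 z1 = plucker (cyclic_basis r q s).
Proof.
case/scroll_parametrization=>
  a [b [k [e [f [ef0 [-> -> ->] [-> -> ->] -> ->]]]]].
(* The minor is linear in q and not identically zero, since (e, f) is nonzero; hence it takes every
   value k. *)
have [q Eq] : exists q, row2_minor (\row_j [:: e; f]`_j) q = k.
  have [e0|e0] := eqVneq e 0; last first.
    exists (\row_j [:: 0; k / e]`_j); rewrite /row2_minor !mxE /=.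
    by rewrite mulr0 subr0 mulrC divfK.
  move: ef0; rewrite e0 eqxx /= => f0; exists (\row_j [:: - k / f; 0]`_j).
  by rewrite /row2_minor !mxE /= mul0r mulNr mulrN sub0r opprK mulrC divfK.
exists (\row_j [:: a; b]`_j), q, (\row_j [:: e; f]`_j); split.
  apply: contraTneq ef0 => /rowP s0; have := (s0 0, s0 1).
  by rewrite !mxE /= => -[-> ->]; rewrite eqxx.
by rewrite plucker_cyclic_basis Eq !mxE.
Qed.

Lemma grassmann_image_set_XY (F : fieldType) (L : {vspace 'rV[F]_20}) :
  grassmann_image_set (@X_submodule F) L \/
  grassmann_image_set (@Y_submodule F) L <-> proj_zeros (equations F) L.
Proof.
have -> : grassmann_image_set (@X_submodule F) L \/
    grassmann_image_set (@Y_submodule F) L <->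
    exists r q s, [/\ s != 0, (r != 0) || (row2_minor s q != 0) &
      L = <[plucker (cyclic_basis r q s)]>%VS].
  split=> [XY|[r [q [s [s0 rk0 EL]]]]].
    have [U [W [UXY WU WL]]] : grassmann_image_set
        (fun U => @X_submodule F U \/ @Y_submodule F U) L.
      by case: XY => -[U [W [CU WU WL]]]; exists U, W; split=> //; [left|right].
    case/X_or_Y_submoduleP: UXY => r [q [s [s0 rk0 UE]]]; exists r, q, s.
    split=> //; apply/grassmann_image_cyclicP.
      exact: plucker_cyclic_basis_neq0.
    by exists U, W.
  have [_ /(_ EL)] := grassmann_image_cyclicP L
    (plucker_cyclic_basis_neq0 s0 rk0).
  move=> [U [W [UE WU WL]]].
  have /X_or_Y_submoduleP [XU|YU] : exists r q s,
      [/\ s != 0, (r != 0) || (row2_minor s q != 0) &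
        forall v, U v <-> cyclic_submodule (ternmx r q s) v].
  - by exists r, q, s.
  - by left; exists U, W.
  - by right; exists U, W.
split=> [[r [q [s [s0 rk0 ->]]]]|[dimL L0]].
  split; first by rewrite dim_vline plucker_cyclic_basis_neq0.
  move=> v /vlineP[c ->]; apply/zeros_equationsP.
  rewrite plucker_cyclic_basis scroll_pointZ; do 8!eexists; split=> //=.
  by do ![apply/andP; split=> //]; apply/eqP; ring.
have [v v0 EL] : exists2 v, v != 0 & L = <[v]>%VS.
  exists (vpick L); first by rewrite vpick0 -dimv_eq0 dimL.
  apply/eqP; rewrite eq_sym eqEdim -memvE memv_pick dimL dim_vline vpick0.
  by rewrite -dimv_eq0 dimL.
have /L0/zeros_equationsP : v \in L by rewrite EL memv_line.
move=> [x0 [x1 [x2 [y0 [y1 [y2 [z0 [z1 [Ev /scroll_point_plucker]]]]]]]]].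
move=> [r [q [s [s0]]]]; rewrite -Ev => Ev'; exists r, q, s.
split=> //; last by rewrite EL Ev'.
(* If r and k both vanished, every coordinate of v would be zero. *)
apply: contraTT v0; rewrite negb_or !negbK => /andP [/eqP r0 /eqP k0].
rewrite Ev' plucker_cyclic_basis k0 r0 !mxE !mul0r.
apply/eqP/rowP=> -[l lt_l]; rewrite !mxE /=.
by move: l lt_l; do 20![case=> [//|]].
Qed.

(** * Ideal membership and the symmetries of the scroll *)

Lemma in_ideal_mem (F : fieldType) n (gs : seq {mpoly F[n]}) f :
  f \in gs -> in_ideal gs f.
Proof.
move=> fgs; have lt_f : (index f gs < size gs)%N by rewrite index_mem.
exists (fun i => (i == Ordinal lt_f)%:R).
rewrite (bigD1 (Ordinal lt_f)) //= eqxx mul1r nth_index //.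
by rewrite big1 ?addr0 // => i /negPf ->; rewrite mul0r.
Qed.

Lemma in_ideal_add (F : fieldType) n (gs : seq {mpoly F[n]}) f g :
  in_ideal gs f -> in_ideal gs g -> in_ideal gs (f + g).
Proof.
move=> [q ->] [r ->]; exists (fun i => q i + r i).
by rewrite -big_split; apply: eq_bigr => i _; rewrite mulrDl.
Qed.

Lemma in_ideal_mul (F : fieldType) n (gs : seq {mpoly F[n]}) h f :
  in_ideal gs f -> in_ideal gs (h * f).
Proof.
move=> [q ->]; exists (fun i => h * q i).
by rewrite mulr_sumr; apply: eq_bigr => i _; rewrite mulrA.
Qed.

Lemma in_ideal_opp (F : fieldType) n (gs : seq {mpoly F[n]}) f :
  in_ideal gs (- f) -> in_ideal gs f.
Proof. by move=> /(in_ideal_mul (-1)); rewrite mulN1r opprK. Qed.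

(** Where x0 is invertible, the four quadrics solve for x2, y1, y2 and z1. Substituting these values
    in the other five and clearing denominators costs at most x0^2 and yields the coefficients given
    to [comb]. *)
Lemma scroll_chart_x (R : comNzRingType) (I : R -> Prop)
    (x0 x1 x2 y0 y1 y2 z0 z1 : R) :
  (forall f g, I f -> I g -> I (f + g)) -> (forall h f, I f -> I (h * f)) ->
  I (x0 * x2 - x1 ^+ 2) -> I (x0 * y1 - x1 * y0) -> I (x0 * y2 - y0 * x2) ->
  I (x0 * z1 - x1 * z0) ->
  forall f, f \in scroll_quadrics x0 x1 x2 y0 y1 y2 z0 z1 -> I (x0 ^+ 2 * f).
Proof.
move=> ID IM I1 I2 I3 I4.
have comb a1 a2 a3 a4 f :
    f = a1 * (x0 * x2 - x1 ^+ 2) + a2 * (x0 * y1 - x1 * y0)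
      + a3 * (x0 * y2 - y0 * x2) + a4 * (x0 * z1 - x1 * z0) -> I f.
  by move->; apply: (ID _ _ (ID _ _ (ID _ _ _ _) _) _); apply: IM.
move=> f; rewrite !inE.
case/or4P=> [/eqP->|/eqP->|/eqP->|/or4P[/eqP->|/eqP->|/eqP->|/or3P[]/eqP->]].
- by apply: IM.
- by apply: (comb (y0 ^+ 2) (- (x0 * y1 + x1 * y0)) (x0 * y0) 0); ring.
- by apply: (comb 0 (x0 * x2) (- (x0 * x1)) 0); ring.
- by apply: IM.
- by apply: IM.
- by apply: IM.
- by apply: (comb (- (x0 * z0)) 0 0 (x0 * x1)); ring.
- by apply: (comb 0 (- (x0 * z0)) 0 (x0 * y0)); ring.
- by apply: (comb (- (y0 * z0)) (x0 * z1) (- (x0 * z0)) (x1 * y0)); ring.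
Qed.

(** Where z0 is invertible, the four quadrics solve for x1, x2, y1 and y2, and the coefficients
    arise as in the chart of x0. *)
Lemma scroll_chart_z (R : comNzRingType) (I : R -> Prop)
    (x0 x1 x2 y0 y1 y2 z0 z1 : R) :
  (forall f g, I f -> I g -> I (f + g)) -> (forall h f, I f -> I (h * f)) ->
  I (x0 * z1 - x1 * z0) -> I (x1 * z1 - x2 * z0) -> I (y0 * z1 - y1 * z0) ->
  I (y1 * z1 - y2 * z0) ->
  forall f, f \in scroll_quadrics x0 x1 x2 y0 y1 y2 z0 z1 -> I (z0 ^+ 2 * f).
Proof.
move=> ID IM I1 I2 I3 I4.
have comb a1 a2 a3 a4 f :
    f = a1 * (x0 * z1 - x1 * z0) + a2 * (x1 * z1 - x2 * z0)
      + a3 * (y0 * z1 - y1 * z0) + a4 * (y1 * z1 - y2 * z0) -> I f.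
  by move->; apply: (ID _ _ (ID _ _ (ID _ _ _ _) _) _); apply: IM.
move=> f; rewrite !inE.
case/or4P=> [/eqP->|/eqP->|/eqP->|/or4P[/eqP->|/eqP->|/eqP->|/or3P[]/eqP->]].
- by apply: (comb (z0 * x1) (- (z0 * x0)) 0 0); ring.
- by apply: (comb 0 0 (z0 * y1) (- (z0 * y0))); ring.
- by apply: (comb 0 (- (z0 * y1)) 0 (z0 * x1)); ring.
- by apply: (comb (z1 * y0) (z0 * y0) (- (z1 * x0)) (- (z0 * x0))); ring.
- by apply: (comb (z0 * y0) 0 (- (z0 * x0)) 0); ring.
- by apply: IM.
- by apply: IM.
- by apply: IM.
- by apply: IM.
Qed.

(** Exchanging the two conics of the scroll, or reversing the parameter (e, f), permutes the
    quadrics only up to sign, which ideals do not notice. These symmetries reduce the six charts to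
    those of x0 and z0. *)
Definition sub_up_to_sign (R : nzRingType) (s t : seq R) :=
  forall f, f \in s -> f \in t \/ - f \in t.

Lemma scroll_quadrics_swap (R : comNzRingType) (x0 x1 x2 y0 y1 y2 z0 z1 : R) :
  sub_up_to_sign (scroll_quadrics x0 x1 x2 y0 y1 y2 z0 z1)
                 (scroll_quadrics y0 y1 y2 x0 x1 x2 z0 z1).
Proof.
move=> f; rewrite !inE.
case/or4P=> [/eqP->|/eqP->|/eqP->|/or4P[/eqP->|/eqP->|/eqP->|/or3P[]/eqP->]];
  rewrite ?eqxx ?orbT; try (by left); right.
- by rewrite opprB [x2 * _]mulrC [x1 * _]mulrC eqxx !orbT.
- by rewrite opprB eqxx !orbT.
- by rewrite opprB [x1 * _]mulrC [x0 * _]mulrC eqxx !orbT.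
Qed.

Lemma scroll_quadrics_rev (R : comNzRingType) (x0 x1 x2 y0 y1 y2 z0 z1 : R) :
  sub_up_to_sign (scroll_quadrics x0 x1 x2 y0 y1 y2 z0 z1)
                 (scroll_quadrics x2 x1 x0 y2 y1 y0 z1 z0).
Proof.
move=> f; rewrite !inE.
case/or4P=> [/eqP->|/eqP->|/eqP->|/or4P[/eqP->|/eqP->|/eqP->|/or3P[]/eqP->]].
- by left; rewrite mulrC eqxx.
- by left; rewrite [y0 * _]mulrC eqxx orbT.
- by left; rewrite eqxx !orbT.
- by right; rewrite opprB [y0 * _]mulrC [x0 * _]mulrC eqxx !orbT.
- by left; rewrite eqxx !orbT.
- by right; rewrite opprB eqxx !orbT.
- by right; rewrite opprB eqxx !orbT.
- by right; rewrite opprB eqxx !orbT.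
- by right; rewrite opprB eqxx !orbT.
Qed.

(** * Jacobians with triangular pivots *)

Lemma mderiv_var (R : nzRingType) n (i j : 'I_n) :
  ('X_i)^`M(j) = (i == j)%:R :> {mpoly R[n]}.
Proof.
rewrite mderivX mnm1E; case: eqVneq => [->|_]; last by rewrite scale0r.
by rewrite scale1r -{1}[U_(j)%MM]add0m addmK mpolyX0.
Qed.

Lemma mderiv_binomial (R : comNzRingType) n (a b c d j : 'I_n) (x : 'I_n -> R) :
  ('X_a * 'X_b - 'X_c * 'X_d)^`M(j).@[x] =
  ((a == j)%:R * x b + x a * (b == j)%:R)
  - ((c == j)%:R * x d + x c * (d == j)%:R).
Proof.
rewrite mderivB !mderivM !mderiv_var mevalB !mevalD !mevalM !mevalXU.
by rewrite !rmorph_nat.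
Qed.

(** Each form is paired with a pivot variable. The minor of the Jacobian on the pivot columns is
    lower triangular with nonzero diagonal, hence invertible. *)
Lemma jacobian_row_free (F : fieldType) n (s : seq ({mpoly F[n]} * 'I_n)) x :
  all (fun gc => (gc.1)^`M(gc.2).@[x] != 0) s ->
  pairwise (fun gc gc' => (gc.1)^`M(gc'.2).@[x] == 0) s ->
  row_free (jacobian (unzip1 s) x).
Proof.
move=> /all_nthP s_diag s_trig.
pose J := jacobian (unzip1 s) x.
(* A nonempty list supplies the default element for [nth]; the empty one is settled separately, as n
   may be 0. *)
have [-> |[gc0 s0]] : s = [::] \/ exists gc, gc \in s.
- by case: (s) => [|gc ?]; [left | right; exists gc; rewrite mem_head].
- by apply: inj_row_free => u _; apply/rowP=> -[].
have ltS (i : 'I_(size (unzip1 s))) : (i < size s)%N by rewrite -(size_map fst).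
pose A : 'M_(size (unzip1 s)) :=
  colsub (fun i : 'I_(size (unzip1 s)) => (nth gc0 s i).2) J.
have AE i j : A i j = (nth gc0 s i).1^`M((nth gc0 s j).2).@[x].
  by rewrite !mxE (nth_map gc0).
have trigA : is_trig_mx A.
  apply/is_trig_mxP=> i j lt_ij; rewrite AE; apply/eqP.
  by have /(pairwiseP gc0) := s_trig; apply; rewrite ?inE.
have uA : A \in unitmx.
  rewrite unitmxE det_trig // unitfE; apply/prodf_neq0 => i _.
  by rewrite AE s_diag.
have fA : row_free A by rewrite row_free_unit.
apply: inj_row_free => u uJ; apply: (row_free_inj fA).
by rewrite mul0mx mulmx_colsub uJ; apply/matrixP=> i j; rewrite !mxE.
Qed.

(* Positions in [triples] of the coordinates that the linear equations express
   through the remaining ones, and of the entries of the scroll matrix. *)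
Definition linear_pivots : seq nat :=
  [:: 0; 1; 2; 3; 4; 9; 10; 15; 16; 17; 12; 6]%N.
Definition scroll_indices : seq nat := [:: 5; 7; 8; 11; 13; 14; 18; 19]%N.

Lemma eq_inord20 (a b : nat) :
  (a < 20)%N -> (b < 20)%N -> (inord a == inord b :> 'I_20) = (a == b).
Proof. by move=> a20 b20; rewrite -val_eqE /= !inordK. Qed.

(** No linear equation contains the pivot of another one: p_245 and p_145 are not pivots. *)
Lemma linear_mderiv (F : fieldType) (x : 'I_20 -> F) :
  let s := zip (equations_i F) [seq inord k | k <- linear_pivots] in
  all (fun gc => (gc.1)^`M(gc.2).@[x] != 0) s &&
  pairwise (fun gc gc' => (gc.1)^`M(gc'.2).@[x] == 0) s.
Proof.
pose D (f : {mpoly F[20]}) (c : 'I_20) := f^`M(c).@[x].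
change (let s := zip (equations_i F) [seq inord k | k <- linear_pivots] in
  all (fun gc => D gc.1 gc.2 != 0) s &&
  pairwise (fun gc gc' => D gc.1 gc'.2 == 0) s).
have DB f g c : D (f - g) c = D f c - D g c by rewrite /D mderivB mevalB.
have Dp i j k c : (index (i, j, k) triples < 20)%N -> (c < 20)%N ->
    D (p i j k) (inord c) = (index (i, j, k) triples == c)%:R.
  by move=> ? ?; rewrite /D mderiv_var eq_inord20 // rmorph_nat.
rewrite /equations_i; move: D (@p F) DB Dp => D q DB Dp.
rewrite /= !DB !Dp //=.
by rewrite /= !subr0 !oner_neq0 !eqxx.
Qed.

Lemma equations_i_homog (F : fieldType) :
  {in equations_i F, forall f, f \is 1.-homog}.
Proof.
have hp i j k : @p F i j k \is 1.-homog by rewrite dhomogX; apply/eqP/mdeg1.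
rewrite /equations_i; move: (@p F) hp => q hp.
by apply/allP; rewrite /= !rpredB ?hp.
Qed.

Lemma scroll_quadrics_homog (R : comNzRingType) n
    (x0 x1 x2 y0 y1 y2 z0 z1 : {mpoly R[n]}) :
  all (fun f => f \is 1.-homog) [:: x0; x1; x2; y0; y1; y2; z0; z1] ->
  {in scroll_quadrics x0 x1 x2 y0 y1 y2 z0 z1, forall f, f \is 2.-homog}.
Proof.
have hM (f g : {mpoly R[n]}) : f \is 1.-homog -> g \is 1.-homog ->
  f * g \is 2.-homog by exact: (@dhomogM _ _ _ 1 _ 1).
move=> /= /and5P [h1 h2 h3 h4] /and5P [h5 h6 h7 h8 _].
by apply/allP; rewrite /= !rpredB //; do ?[apply: hM].
Qed.

(** * Smoothness in a single chart *)

Definition quadratic_equations (F : fieldType) : seq {mpoly F[20]} :=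
  equations_ii F ++ equations_iii F ++ equations_iv F.

(** The list [l] gives the positions of x0, ..., z1 after a symmetry, [u] selects the coordinate
    that is nonzero in the chart, and [s] pairs four quadrics with their pivots. With the twelve
    linear forms this makes 16 = 19 - 3 generators. *)
Lemma smooth_at_chart (F : fieldType) (x : 'I_20 -> F) (l : seq nat)
    (u : nat) (s : seq ({mpoly F[20]} * 'I_20)) :
  let X k : {mpoly F[20]} := 'X_(inord (nth 0%N l k)) in
  let S := scroll_quadrics (X 0) (X 1) (X 2) (X 3) (X 4) (X 5) (X 6) (X 7) in
  perm_eq l scroll_indices ->
  sub_up_to_sign S (quadratic_equations F) ->
  sub_up_to_sign (quadratic_equations F) S ->
  size s = 4%N -> {subset unzip1 s <= S} ->
  (forall gs, {subset unzip1 s <= gs} ->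
     forall f, f \in S -> in_ideal gs (X u ^+ 2 * f)) ->
  x (inord (nth 0%N l u)) != 0 ->
  all (fun gc => (gc.1)^`M(gc.2).@[x] != 0) s ->
  pairwise (fun gc gc' => (gc.1)^`M(gc'.2).@[x] == 0) s ->
  smooth_at (equations F) 3 x.
Proof.
move=> X S l_scroll SQ QS size_s sS chart xu s_diag s_trig.
pose sL : seq ({mpoly F[20]} * 'I_20) :=
  zip (equations_i F) [seq inord k | k <- linear_pivots].
have sLE : unzip1 sL = equations_i F by rewrite unzip1_zip.
have homX k : X k \is 1.-homog by rewrite dhomogX; apply/eqP/mdeg1.
have homS : {in S, forall f, f \is 2.-homog}.
  by apply: scroll_quadrics_homog; rewrite /= !homX.
have lin_mderivS f k : f \in S -> k \in linear_pivots ->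
    f^`M(inord k).@[x] = 0.
  move=> fS k_lin.
  have lk i : (i < 8)%N -> (inord (nth 0%N l i) == inord k :> 'I_20) = false.
    move=> i8; have : nth 0%N l i \in scroll_indices.
      by rewrite -(perm_mem l_scroll) mem_nth // (perm_size l_scroll).
    move: (nth 0%N l i) => c.
    have /allP dis : all (fun c => all (fun k =>
        [&& c < 20, k < 20 & c != k]%N) linear_pivots) scroll_indices by [].
    by move=> /dis/allP/(_ k k_lin)/and3P [? ? /negPf <-]; rewrite eq_inord20.
  move: fS; rewrite !inE !expr2.
  case/or4P=> [/eqP->|/eqP->|/eqP->|/or4P[/eqP->|/eqP->|/eqP->|/or3P[]/eqP->]];
    by rewrite mderiv_binomial !lk // !mul0r !mulr0 !addr0 subr0.
exists (unzip1 (s ++ sL)), (X u ^+ 2).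
have -> : unzip1 (s ++ sL) = unzip1 s ++ equations_i F by rewrite -sLE -map_cat.
have fg f : f \in S \/ - f \in S ->
    in_ideal (unzip1 s ++ equations_i F) (X u ^+ 2 * f).
  have sub : {subset unzip1 s <= unzip1 s ++ equations_i F}.
    by move=> g gs; rewrite mem_cat gs.
  case=> /(chart _ sub) // If.
  by apply: in_ideal_opp; rewrite -mulrN.
split.
- by rewrite size_cat size_map size_s.
- move=> g; rewrite mem_cat => /orP [/sS gS|g_i].
    split; first by exists 2%N; apply: homS.
    by case: (SQ g gS) => gQ; [|apply: in_ideal_opp];
      apply: in_ideal_mem; rewrite mem_cat gQ orbT.
  split; first by exists 1%N; apply: equations_i_homog.
  by apply: in_ideal_mem; rewrite mem_cat g_i.
- have /andP [L_diag L_trig] := linear_mderiv x.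
  rewrite -sLE -map_cat; apply: jacobian_row_free.
    by rewrite all_cat s_diag.
  (* The quadrics precede the linear forms because they do not involve the linear pivots, whereas a
     linear form may contain a pivot of a quadric. *)
  rewrite pairwise_cat s_trig L_trig !andbT; apply/allrelP => gc gc' gcs gcL.
  have : gc'.2 \in unzip2 sL by apply: map_f.
  rewrite unzip2_zip // => /mapP [k k_lin ->].
  by rewrite lin_mderivS // sS // map_f.
- split; first by exists 2%N; apply: (@dhomogMn _ _ _ 1 _ 2).
  by rewrite rmorphXn /= mevalXU expf_neq0.
- move=> f; rewrite mem_cat => /orP [f_i|/QS/fg //].
  by apply/in_ideal_mul/in_ideal_mem; rewrite mem_cat f_i orbT.
Qed.

Lemma eq_scroll_var (l : seq nat) (a b : nat) :
  perm_eq l scroll_indices -> (a < 8)%N -> (b < 8)%N ->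
  (inord (nth 0%N l a) == inord (nth 0%N l b) :> 'I_20) = (a == b).
Proof.
move=> l_scroll a8 b8.
have sl : size l = 8%N by rewrite (perm_size l_scroll).
have l20 c : (c < 8)%N -> (nth 0%N l c < 20)%N.
  move=> c8; have : nth 0%N l c \in scroll_indices.
    by rewrite -(perm_mem l_scroll) mem_nth ?sl.
  by apply/allP: (nth 0%N l c).
by rewrite eq_inord20 ?l20 // nth_uniq ?sl // (perm_uniq l_scroll).
Qed.

Lemma scroll_quadrics_sub_x (R : comNzRingType) (x0 x1 x2 y0 y1 y2 z0 z1 : R) :
  {subset [:: x0 * x2 - x1 * x1; x0 * y1 - x1 * y0; x0 * y2 - y0 * x2;
              x0 * z1 - x1 * z0]
   <= scroll_quadrics x0 x1 x2 y0 y1 y2 z0 z1}.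
Proof. by apply/allP; rewrite /= !inE !expr2 !eqxx !orbT. Qed.

Lemma scroll_quadrics_sub_z (R : comNzRingType) (x0 x1 x2 y0 y1 y2 z0 z1 : R) :
  {subset [:: x0 * z1 - x1 * z0; x1 * z1 - x2 * z0; y0 * z1 - y1 * z0;
              y1 * z1 - y2 * z0]
   <= scroll_quadrics x0 x1 x2 y0 y1 y2 z0 z1}.
Proof. by apply/allP; rewrite /= !inE !eqxx !orbT. Qed.

Lemma smooth_at_chart_x (F : fieldType) (x : 'I_20 -> F) (l : seq nat) :
  let X k : {mpoly F[20]} := 'X_(inord (nth 0%N l k)) in
  let S := scroll_quadrics (X 0) (X 1) (X 2) (X 3) (X 4) (X 5) (X 6) (X 7) in
  perm_eq l scroll_indices ->
  sub_up_to_sign S (quadratic_equations F) ->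
  sub_up_to_sign (quadratic_equations F) S ->
  x (inord (nth 0%N l 0)) != 0 -> smooth_at (equations F) 3 x.
Proof.
move=> X S l_scroll SQ QS x0; pose c k : 'I_20 := inord (nth 0%N l k).
(* The pivots are x2, y1, y2, z1, each with derivative x0. Only the third quadric contains an
   earlier pivot, x2. The square is written as a product to fit [mderiv_binomial]. *)
pose s := [:: (X 0 * X 2 - X 1 * X 1, c 2); (X 0 * X 4 - X 1 * X 3, c 4);
              (X 0 * X 5 - X 3 * X 2, c 5); (X 0 * X 7 - X 1 * X 6, c 7)].
have cE a b : (a < 8)%N -> (b < 8)%N -> (c a == c b) = (a == b).
  exact: eq_scroll_var.
apply: (smooth_at_chart (u := 0%N) (s := s) l_scroll SQ QS _ _ _ x0 _ _).
- by [].
- exact: scroll_quadrics_sub_x.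
- move=> gs /allP /and5P [g1 g2 g3 g4 _].
  apply: scroll_chart_x; [exact: in_ideal_add | exact: in_ideal_mul | | | |];
    exact: in_ideal_mem.
- rewrite /= !mderiv_binomial !cE //=.
  by rewrite !(mul1r, mul0r, mulr1, mulr0, addr0, add0r, subr0) !x0.
- rewrite /= !mderiv_binomial !cE //=.
  by rewrite !(mul1r, mul0r, mulr1, mulr0, addr0, add0r, oppr0) !eqxx.
Qed.

Lemma smooth_at_chart_z (F : fieldType) (x : 'I_20 -> F) (l : seq nat) :
  let X k : {mpoly F[20]} := 'X_(inord (nth 0%N l k)) in
  let S := scroll_quadrics (X 0) (X 1) (X 2) (X 3) (X 4) (X 5) (X 6) (X 7) in
  perm_eq l scroll_indices ->
  sub_up_to_sign S (quadratic_equations F) ->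
  sub_up_to_sign (quadratic_equations F) S ->
  x (inord (nth 0%N l 6)) != 0 -> smooth_at (equations F) 3 x.
Proof.
move=> X S l_scroll SQ QS z0; pose c k : 'I_20 := inord (nth 0%N l k).
(* The pivots are x1, x2, y1, y2, each with derivative -z0. The order matters, since x1 and y1 recur
   in the quadrics that follow theirs. *)
pose s := [:: (X 0 * X 7 - X 1 * X 6, c 1); (X 1 * X 7 - X 2 * X 6, c 2);
              (X 3 * X 7 - X 4 * X 6, c 4); (X 4 * X 7 - X 5 * X 6, c 5)].
have cE a b : (a < 8)%N -> (b < 8)%N -> (c a == c b) = (a == b).
  exact: eq_scroll_var.
apply: (smooth_at_chart (u := 6%N) (s := s) l_scroll SQ QS _ _ _ z0 _ _).
- by [].
- exact: scroll_quadrics_sub_z.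
- move=> gs /allP /and5P [g1 g2 g3 g4 _].
  apply: scroll_chart_z; [exact: in_ideal_add | exact: in_ideal_mul | | | |];
    exact: in_ideal_mem.
- rewrite /= !mderiv_binomial !cE //=.
  by rewrite !(mul1r, mul0r, mulr1, mulr0, addr0, add0r, sub0r, oppr_eq0) !z0.
- rewrite /= !mderiv_binomial !cE //=.
  by rewrite !(mul1r, mul0r, mulr1, mulr0, addr0, add0r, oppr0) !eqxx.
Qed.

(** * Smoothness at every point over every extension field *)

Lemma sub_up_to_sign_trans (R : nzRingType) (s t u : seq R) :
  sub_up_to_sign s t -> sub_up_to_sign t u -> sub_up_to_sign s u.
Proof.
move=> st tu f /st [/tu //|/tu []]; first by right.
by rewrite opprK; left.
Qed.

Lemma smooth_at_equations (F : fieldType) (x : 'I_20 -> F) :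
  (exists i, x i != 0) -> (forall f, f \in equations F -> f.@[x] = 0) ->
  smooth_at (equations F) 3 x.
Proof.
move=> [i xi] x_zero; pose c k := x (inord k).
have [c5|c5] := eqVneq (c 5) 0; last first.
  by apply: (@smooth_at_chart_x _ _ scroll_indices) => // f; left.
have [c11|c11] := eqVneq (c 11) 0; last first.
  (* Exchanging the x's and y's moves y0 to the front; below, reversal does so for x2, both
     symmetries together for y2, and reversal puts z1 in the place of z0. *)
  apply: (@smooth_at_chart_x _ _ [:: 11; 13; 14; 5; 7; 8; 18; 19]%N) => //;
    exact: scroll_quadrics_swap.
have [c8|c8] := eqVneq (c 8) 0; last first.
  apply: (@smooth_at_chart_x _ _ [:: 8; 7; 5; 14; 13; 11; 19; 18]%N) => //;
    exact: scroll_quadrics_rev.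
have [c14|c14] := eqVneq (c 14) 0; last first.
  apply: (@smooth_at_chart_x _ _ [:: 14; 13; 11; 8; 7; 5; 19; 18]%N) => //;
    apply: sub_up_to_sign_trans (@scroll_quadrics_rev _ _ _ _ _ _ _ _ _) _;
    exact: scroll_quadrics_swap.
have [c18|c18] := eqVneq (c 18) 0; last first.
  by apply: (@smooth_at_chart_z _ _ scroll_indices) => // f; left.
have [c19|c19] := eqVneq (c 19) 0; last first.
  apply: (@smooth_at_chart_z _ _ [:: 8; 7; 5; 14; 13; 11; 19; 18]%N) => //;
    exact: scroll_quadrics_rev.
(* Outside the six charts the quadrics leave x1^2 = y1^2 = 0, so all coordinates vanish, contrary to
   the choice of i. *)
have /zeros_equationsP [x0 [x1 [x2 [y0 [y1 [y2 [z0 [z1 []]]]]]]]] :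
    forall f, f \in equations F -> f.@[fun i => (\row_i x i) 0 i] = 0.
  by move=> f /x_zero <-; apply: meval_eq => j; rewrite mxE.
move=> /rowP xE.
have cE k : c k = scroll_point x0 x1 x2 y0 y1 y2 z0 z1 0 (inord k).
  by rewrite -xE mxE.
move: c5 c8 c11 c14 c18 c19; rewrite !cE !mxE !inordK //=.
move=> E5 E8 E11 E14 E18 E19.
rewrite E5 E8 E11 E14 !mul0r !sub0r !oppr_eq0 !expf_eq0 /=.
move=> /and3P [/eqP E7 /eqP E13 _]; case/negP: xi; apply/eqP.
have -> : x i = scroll_point x0 x1 x2 y0 y1 y2 z0 z1 0 i by rewrite -xE mxE.
rewrite E5 E7 E8 E11 E13 E14 E18 E19 mxE; case: i => l /=; move: l.
by do 20![case=> [//|]].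
Qed.

(** The coefficients are integers, so smoothness at points over K is the case of the base field
    K. *)
Lemma map_mpoly_equations (F K : fieldType) (iota : {rmorphism F -> K}) :
  [seq map_mpoly iota f | f <- equations F] = equations K.
Proof.
have mp i j k : map_mpoly iota (p i j k) = p i j k by rewrite map_mpolyX.
rewrite !equationsE map_cat; congr (_ ++ _).
  rewrite /equations_i; move: (@p F) (@p K) mp => q q' mp.
  by rewrite /= !rmorphB /= !mp.
move: (@p F) (@p K) mp => q q' mp.
by rewrite /= !expr2 !rmorphB !rmorphM /= !mp.
Qed.

Theorem theorem1 (F : fieldType) :
  (forall L : {vspace 'rV[F]_20},
     grassmann_image_set (@X_submodule F) L \/
     grassmann_image_set (@Y_submodule F) L
     <-> proj_zeros (equations F) L) /\
  smooth_variety (equations F).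
Proof.
split; first exact: grassmann_image_set_XY.
split; last first.
  exists 3 => K iota x; rewrite map_mpoly_equations.
  exact: smooth_at_equations.
move=> f; rewrite equationsE mem_cat => /orP [/equations_i_homog|].
  by exists 1%N.
move=> fQ; exists 2%N; move: f fQ; apply: scroll_quadrics_homog.
apply/allP=> g; rewrite !inE => /or4P [||| /or4P[||| /orP[]]] /eqP->;
  by rewrite dhomogX; apply/eqP/mdeg1.
Qed.
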